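(* Let $E$ be a real Banach space, let $k \in \mathbb{N}_0$, $n \ge 1$, and let $f_1,\dots,f_n:E\to\mathbb{R}$ be $k$-times Fréchet differentiable at a point $x \in E$. Then: 1. (Taylor form) As polynomials in $v \in E$, $$T^k(f_1 \cdots f_n;\, x;\, v) = \pi_{\leq k}\bigl(T^k(f_1;\, x;\, v) \cdots T^k(f_n;\, x;\, v)\bigr).$$ 2. (Ordered-decomposition form) For all $u_1,\dots,u_k\in E$, $$D(f_1 \cdots f_n;\, x;\, u_1,\dots,u_k) = \sum_{(B_1,\dots,B_n) \models [k]} D(f_1;\, x;\, u_{B_1}) \cdots D(f_n;\, x;\, u_{B_n}),$$ where the sum runs over all ordered $n$-decompositions of $[k]=\{1,\dots,k\}$ (empty blocks allowed), with the convention $D(f_i; x; u_\emptyset) = f_i(x)$ for the empty block. 3. (Multi-index form) If $E=\mathbb{R}^d$ and $\nu\in\mathbb{N}_0^d$ with $|\nu|=k$, then $$\frac{\partial^\nu(f_1 \cdots f_n)(x)}{\nu!} = \sum_{\substack{\nu_1,\dots,\nu_n \in \mathbb{N}_0^d \\ \nu_1 + \dots + \nu_n = \nu}} \frac{\partial^{\nu_1}f_1(x)}{\nu_1!} \cdots \frac{\partial^{\nu_n}f_n(x)}{\nu_n!}.$$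
   Context: $f_1\cdots f_n$ denotes the pointwise product. A function $f:E\to\mathbb{R}$ is $k$-times Fréchet differentiable at $x$ if (for $k\ge1$) it is $(k-1)$-times Fréchet differentiable in a neighborhood of $x$ and its $(k-1)$-st derivative is Fréchet differentiable at $x$; for $k=0$ this is no condition. For $m\le k$, $D(f;x;v_1,\dots,v_m)$ denotes the $m$-th Fréchet derivative at $x$ evaluated on $v_1,\dots,v_m$ (the order being the number of direction arguments); it is a bounded symmetric $m$-linear form, and for $m=0$ it is $f(x)$. The (full) Taylor polynomial is $T^k(f;x;v) = \sum_{\ell=0}^k \frac{1}{\ell!} D(f;x;\underbrace{v,\dots,v}_{\ell})$. A polynomial map on $E$ is a finite sum $p=\sum_j p_j$ of homogeneous polynomials $p_j(v) = \frac{1}{j!}A_j[v,\dots,v]$ with $A_j$ a bounded symmetric $j$-linear form; the components $p_j$ are uniquely determined by $p$, and $\pi_{\le k}(p) := \sum_{j\le k} p_j$. An ordered $n$-decomposition $(B_1,\dots,B_n)\models I$ of a finite set $I$ is a tuple of pairwise disjoint, possibly empty, subsets $B_i\subset I$ with union $I$ (equivalently, a map $I\to\{1,\dots,n\}$). For $B\subset [k]$, $u_B := (u_b)_{b\in B}$. For $\nu\in\mathbb{N}_0^d$: $|\nu| = \sum_i\nu_i$, $\nu! = \prod_i \nu_i!$, $v^\nu=\prod_i v_i^{\nu_i}$. The partial derivative $\partial^\nu f(x)$, $|\nu|\le k$, is the coefficient of $v^\nu/\nu!$ in $T^k(f;x;v)$, i.e. $T^k(f;x;v)=\sum_{0\le|\nu|\le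 k} \frac{v^\nu}{\nu!}\,\partial^\nu f(x)$ (the usual mixed partial derivative, with $\partial^0 f = f$). *)

(* Defs.v *)
From HB Require Import structures.
From mathcomp Require Import all_boot all_order all_algebra.
From mathcomp Require Import boolp classical_sets functions reals topology.
From mathcomp Require Import normedtype landau derive.
From mathcomp Require mpoly.
(* Selective, because the notations of mpoly clash with those of analysis. *)
Import (canonicals, coercions) mpoly.

Set Implicit Arguments.
Unset Strict Implicit.
Unset Printing Implicit Defensive.

Import Order.TTheory GRing.Theory Num.Theory.
Import numFieldNormedType.Exports.

Local Open Scope classical_set_scope.
Local Open Scope ring_scope.

Section BoundedLinear.
Context {R : realType} {E F : normedModType R}.
Implicit Types (f g : E -> F).

(* For linear maps, continuity is boundedness: see linear_bounded_continuous. *)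
Definition blin : {pred E -> F} := mem [set f | linear f /\ continuous f].

Lemma blin_submod_closed : submod_closed blin.
Proof.
split.
  rewrite inE; split => [a u v|x]; last exact: cvg_cst.
  by rewrite /= scaler0 addr0.
move=> a f g; rewrite !inE => -[lf cf] [lg cg]; split => [b u v|x].
  change (a *: f (b *: u + v) + g (b *: u + v) =
          b *: (a *: f u + g u) + (a *: f v + g v)).
  by rewrite lf lg !scalerDr !scalerA (mulrC b a) addrACA.
by apply: cvgD; [apply: cvgZr; exact: cf|exact: cg].
Qed.

HB.instance Definition _ :=
  GRing.isSubmodClosed.Build R (E -> F) blin blin_submod_closed.

Record boundedLinear := BoundedLinear {
  blin_val :> E -> F;
  _ : blin_val \in blin
}.

HB.instance Definition _ := [isSub for blin_val].
HB.instance Definition _ := [Choice of boundedLinear by <:].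
HB.instance Definition _ := [SubChoice_isSubLmodule of boundedLinear by <:].

Implicit Types (A B : boundedLinear).

Definition opnorm A : R := sup [set `|A x| | x in [set x | `|x| <= 1]].

Lemma blin_linear A : linear A.
Proof. by have := valP A; rewrite inE => -[]. Qed.

Lemma blin_continuous A : continuous A.
Proof. by have := valP A; rewrite inE => -[]. Qed.

Lemma blin0 A : A 0 = 0.
Proof.
by have := blin_linear A (-1) 0 0; rewrite scaleN1r oppr0 addr0 scaleN1r addNr.
Qed.

Lemma blinZ A (a : R) x : A (a *: x) = a *: A x.
Proof. by have := blin_linear A a x 0; rewrite blin0 !addr0. Qed.

Lemma opnorm_has_sup A : has_sup [set `|A x| | x in [set x | `|x| <= 1]].
Proof.
split; first by exists `|A 0|, 0 => //=; rewrite normr0.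
pose g : {linear E -> F} :=
  HB.pack (A : E -> F) (GRing.isLinear.Build _ _ _ _ _ (blin_linear A)).
have /linear_bounded_continuous/linear_boundedP/pinfty_ex_gt0 :
  continuous g by exact: blin_continuous.
move=> [r r0 gr]; exists r => _ [x /= x1 <-].
by rewrite (le_trans (gr x))// ler_piMr// ltW.
Qed.

Lemma opnorm_ub A x : `|A x| <= opnorm A * `|x|.
Proof.
have [->|x0] := eqVneq x 0; first by rewrite blin0 !normr0 mulr0.
have nx : 0 < `|x| by rewrite normr_gt0.
have x1 : `|x|^-1 = `| `|x|^-1 | by rewrite ger0_norm// invr_ge0.
rewrite -ler_pdivrMr// mulrC x1 -normrZ -blinZ.
apply: ub_le_sup; first by case: (opnorm_has_sup A).
by exists (`|x|^-1 *: x) => //=; rewrite normrZ normfV normr_id mulVf// gt_eqF.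
Qed.

Lemma opnorm_le A (c : R) : (forall x, `|x| <= 1 -> `|A x| <= c) -> opnorm A <= c.
Proof.
move=> h; apply: ge_sup; first by case: (opnorm_has_sup A).
by move=> _ [x /= x1 <-]; exact: h.
Qed.

Lemma opnorm_ge0 A : 0 <= opnorm A.
Proof.
apply: ub_le_sup; first by case: (opnorm_has_sup A).
by exists 0; rewrite /= ?normr0// blin0 normr0.
Qed.

Lemma opnorm_le1 A x : `|x| <= 1 -> `|A x| <= opnorm A.
Proof.
by move=> x1; rewrite (le_trans (opnorm_ub A x))// ler_piMr// opnorm_ge0.
Qed.

Lemma opnormD A B : opnorm (A + B) <= opnorm A + opnorm B.
Proof.
apply: opnorm_le => x x1; rewrite /= (le_trans (ler_normD _ _))//.
by rewrite lerD// opnorm_le1.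
Qed.

Lemma opnormZ_le (a : R) A : opnorm (a *: A) <= `|a| * opnorm A.
Proof.
apply: opnorm_le => x x1; rewrite /= normrZ.
by rewrite ler_wpM2l// opnorm_le1.
Qed.

Lemma opnormZ (a : R) A : opnorm (a *: A) = `|a| * opnorm A.
Proof.
apply/eqP; rewrite eq_le opnormZ_le /=.
have [->|a0] := eqVneq a 0; first by rewrite normr0 mul0r opnorm_ge0.
rewrite -ler_pdivlMl ?normr_gt0// -normfV.
by rewrite (le_trans _ (opnormZ_le _ _))// scalerA mulVf// scale1r.
Qed.

Lemma opnorm_eq0 A : opnorm A = 0 -> A = 0.
Proof.
move=> A0; apply/val_inj/funext => x /=.
by apply/normr0_eq0/le_anti; rewrite normr_ge0 andbT -(mul0r `|x|) -A0 opnorm_ub.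
Qed.

HB.instance Definition _ :=
  Lmodule_isNormed.Build R boundedLinear opnormD opnormZ opnorm_eq0.

End BoundedLinear.

Arguments boundedLinear {R} E F.

Section HigherDerivatives.
Context {R : realType} {E : normedModType R}.
Implicit Types (f : E -> R) (x v : E) (s : seq E).

(* Bounded m-linear forms in curried form: L(E, L(E, ... L(E, R))) with the
   iterated operator norm, which is the norm sup |A(v_1, ..., v_m)| over the
   unit ball of E^m. *)
Fixpoint mform (m : nat) : normedModType R :=
  if m is m'.+1 then boundedLinear E (mform m') else R.

(* Only meant for [size s = m]; missing arguments are read as 0 and extra
   arguments are ignored. *)
Fixpoint mform_eval (m : nat) : mform m -> seq E -> R :=
  if m is m'.+1 then fun A s => mform_eval (A (head 0 s)) (behead s)
  else fun A _ => A.

(* The junk value 0 only occurs where g is not differentiable. *)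
Definition fderiv (F : normedModType R) (g : E -> F) x : boundedLinear E F :=
  insubd 0 ('d g x : E -> F).

Fixpoint fderivn (m : nat) f : E -> mform m :=
  if m is m'.+1 then fderiv (fderivn m' f) else f.

Fixpoint fdifferentiable (m : nat) f x : Prop :=
  if m is m'.+1 then
    (\forall y \near x, fdifferentiable m' f y) /\
    differentiable (fderivn m' f) x
  else True.

(* The directions are passed as a list, whose length is the order. The head of
   the list is the direction of the last differentiation. *)
Definition D f x s : R := mform_eval (fderivn (size s) f x) s.

Definition taylor (k : nat) f x v : R :=
  \sum_(l < k.+1) (l`!%:R)^-1 * D f x (nseq l v).

Definition symmetric_mform (m : nat) (A : mform m) : Prop :=
  forall s t, size s = m -> perm_eq s t -> mform_eval A s = mform_eval A t.

Definition homogeneous_poly (j : nat) (q : E -> R) : Prop :=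
  exists2 A : mform j, symmetric_mform A &
    forall v, q v = (j`!%:R)^-1 * mform_eval A (nseq j v).

Definition poly_components (p : E -> R) (q : nat -> E -> R) : Prop :=
  (forall j, homogeneous_poly j (q j)) /\
  exists N, (forall j, (N <= j)%N -> q j = 0) /\
            forall v, p v = \sum_(j < N) q j v.

Definition poly_map (p : E -> R) : Prop := exists q, poly_components p q.

(* A polynomial map has exactly one family of components, so the choice made by
   xget is immaterial; the value is 0 when p is not a polynomial map. *)
Definition poly_component (p : E -> R) : nat -> E -> R :=
  xget 0 (poly_components p).

Definition poly_trunc (k : nat) (p : E -> R) v : R :=
  \sum_(j < k.+1) poly_component p j v.

End HigherDerivatives.

Definition ordered_decomposition (n : nat) (I : finType)
    (B : {ffun 'I_n -> {set I}}) : bool :=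
  [forall i, forall j, (i != j) ==> [disjoint B i & B j]] &&
  ((\bigcup_i B i)%SET == [set: I]%SET).

Section MultiIndex.
Context {R : realType} {d : nat}.
Implicit Types (nu : mpoly.multinom d).

Definition mi_fact nu : R := (\prod_i (nu i)`!)%:R.

Definition mi_pow (v : 'rV[R]_d) nu : R := \prod_i v ord0 i ^+ nu i.

Definition taylor_coefs (k : nat) (f : 'rV[R]_d -> R) (x : 'rV[R]_d)
    (c : mpoly.multinom d -> R) : Prop :=
  forall v, taylor k f x v =
    \sum_(nu : mpoly.bmultinom d k.+1) mi_pow v nu / mi_fact nu * c nu.

(* The family c of [taylor_coefs] exists when f is k times differentiable at x,
   and it is then determined at every nu with |nu| <= k; its values at larger
   nu are arbitrary. *)
Definition partial (k : nat) (f : 'rV[R]_d -> R) (x : 'rV[R]_d) :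
    mpoly.multinom d -> R :=
  xget 0 (taylor_coefs k f x).

End MultiIndex.

(* Main.v *)
Require Import Defs.
From HB Require Import structures.
From mathcomp Require Import all_boot all_order all_algebra.
From mathcomp Require Import boolp classical_sets functions reals topology.
From mathcomp Require Import normedtype landau derive.
From mathcomp Require mpoly.
Import (canonicals, coercions) mpoly.

Set Implicit Arguments.
Unset Strict Implicit.
Unset Printing Implicit Defensive.

Import Order.TTheory GRing.Theory Num.Theory.
Import numFieldNormedType.Exports.

Local Open Scope classical_set_scope.
Local Open Scope ring_scope.

(** The proof rests on the Leibniz rule in the form that records, by a word w
over the index set I, which factor receives each of the k successive
derivatives:
  D (prod_i f_i) x s = sum_(w : k.-tuple I) prod_i D f_i x (subword w i s),
where [subword w i s] keeps the directions whose letter in w is i. One more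
differentiation in a direction u acts on each product by the product rule, and
choosing the factor that is differentiated amounts to prefixing one letter to
w; see [sum_subword_cons] and [D_prod]. Evaluated at fixed directions the
derivatives are real functions, so only the one-dimensional product rule
occurs. The selected directions keep their order, as required by derivatives that
are taken one after the other.

It must also be shown that the product is k times differentiable as a map into
the spaces of bounded multilinear forms, for the operator norm. For two
factors, near x, the formula above (with I the booleans) exhibits the k-th
derivative as a finite sum of bounded bilinear expressions in lower
derivatives of f and g; such an expression distributes the k arguments to two
forms ([mform_select]) and is differentiable because its ingredients are. This
is [fdifferentiableM], and an iteration gives [fdifferentiable_prod]. A bounded
multilinear function is turned into an iterated bounded linear map by
[mform_of_multilinear].

A word of length k over n letters amounts to an ordered decomposition of the k
positions, namely into the sets of positions of its letters; this turns the word
formula into the second part.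

For the first part, fix v and encode the Taylor polynomial along the line
through x directed by v as a univariate polynomial [taylor_line]. Formal
differentiation of polynomials obeys the same word formula ([derivn_prod]), so
comparing l-th derivatives at 0 gives that the coefficients of order l <= k of
the product of the [taylor_line]s are those of the [taylor_line] of the product
([coef_prod_taylor_line]). These coefficients, as functions of v, are
homogeneous polynomials, hence they are the components of the product of Taylor
polynomials. Components are unique because v may be replaced by a v for every
scalar a.

For the third part, expanding v in the canonical basis shows that a Taylor
polynomial is a linear combination of the monomials v^nu, with the partial
derivatives as coefficients. Substituting this into the identity for the
coefficient of order k and comparing the coefficients of v^nu, which is
legitimate by Kronecker substitution ([mi_pow_free]), gives the formula. *)

(** * Bounded multilinear forms *)

Section MultilinearForms.
Context {R : realType} {E : normedModType R}.
Implicit Types (s t : seq E) (v : E).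

Lemma mform_eval_linear (m : nat) s : linear (fun A : mform m => @mform_eval R E m A s).
Proof.
elim: m s => [|m IH] s a A B //=; exact: IH.
Qed.

Lemma mform_eval_sum (m : nat) s (J : Type) (r : seq J) (P : pred J)
    (F : J -> @mform R E m) :
  mform_eval (\sum_(j <- r | P j) F j) s = \sum_(j <- r | P j) mform_eval (F j) s.
Proof.
have mD : {morph (fun A : mform m => mform_eval A s) : A B / A + B}.
  by move=> A B; rewrite -{1}[A]scale1r mform_eval_linear scale1r.
apply: (big_morph (fun A : mform m => mform_eval A s) mD).
by apply: (addrI (mform_eval (0 : @mform R E m) s)); rewrite -mD !addr0.
Qed.

Lemma mform_eval0 (m : nat) s : mform_eval (0 : @mform R E m) s = 0.
Proof. by have := @mform_eval_sum m s nat [::] xpredT (fun=> 0); rewrite !big_nil. Qed.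

Lemma mform_evalZ (m : nat) (a : R) (A : @mform R E m) s :
  mform_eval (a *: A) s = a * mform_eval A s.
Proof. by rewrite -[a *: A]addr0 mform_eval_linear mform_eval0 addr0. Qed.

Lemma mform_ext (m : nat) (A B : @mform R E m) :
  (forall s, size s = m -> mform_eval A s = mform_eval B s) -> A = B.
Proof.
elim: m A B => [|m IH] A B AB; first exact: (AB [::]).
by apply/val_inj/funext => v; apply: IH => s sm; apply: (AB (v :: s)); rewrite /= sm.
Qed.

Lemma mform_eval_bound (m : nat) (A : @mform R E m) s :
  size s = m -> `|mform_eval A s| <= `|A| * \prod_(v <- s) `|v|.
Proof.
elim: m A s => [|m IH] A [|v s]//= => [_|[sm]]; first by rewrite big_nil mulr1.
rewrite big_cons mulrA; apply: (le_trans (IH (A v) s sm)).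
apply: ler_wpM2r; first exact: prodr_ge0.
exact: opnorm_ub.
Qed.

Lemma mform_norm_le (m : nat) (A : @mform R E m) (c : R) :
  0 <= c ->
  (forall s, size s = m -> `|mform_eval A s| <= c * \prod_(v <- s) `|v|) ->
  `|A| <= c.
Proof.
elim: m A c => [|m IH] A c c0 Ac; first by have := Ac [::] erefl; rewrite big_nil mulr1.
apply: opnorm_le => v v1; apply: (@le_trans _ _ (c * `|v|)); last by rewrite ler_piMr.
apply: IH => [|s sm]; first exact: mulr_ge0.
by have := Ac (v :: s); rewrite big_cons mulrA; apply; rewrite /= sm.
Qed.

(** The inductive step freezes the first argument v: the forms obtained from the
induction hypothesis depend linearly on v because a form is determined by its
values, and boundedly because the bound of phi passes to the operator norm. All
later constructions of forms go through this lemma, which allows one to work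
with plain functions of a list of vectors. *)
Lemma mform_of_multilinear (m : nat) (phi : seq E -> R) (c : R) :
  (forall s t, (size s + (size t).+1)%N = m ->
     linear (fun v => phi (s ++ v :: t))) ->
  0 <= c -> (forall s, size s = m -> `|phi s| <= c * \prod_(v <- s) `|v|) ->
  exists A : @mform R E m, forall s, size s = m -> mform_eval A s = phi s.
Proof.
elim: m phi c => [|m IH] phi c lphi c0 bphi.
  by exists (phi [::]) => s /size0nil ->.
have /choice[A evalA] : forall v, exists A : @mform R E m,
    forall s, size s = m -> mform_eval A s = phi (v :: s).
  move=> v; apply: (IH (fun s => phi (v :: s)) (c * `|v|)).
  - by move=> s t stm; apply: (lphi (v :: s) t); rewrite /= -stm.
  - exact: mulr_ge0.
  - by move=> s sm; have := bphi (v :: s); rewrite big_cons mulrA; apply; rewrite /= sm.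
have linA : linear A.
  move=> a u v; apply: mform_ext => s sm.
  by rewrite mform_eval_linear !evalA// (lphi [::] s)//= sm.
have boundA v : `|A v| <= c * `|v|.
  apply: mform_norm_le => [|s sm]; first exact: mulr_ge0.
  by rewrite evalA//; have := bphi (v :: s); rewrite big_cons mulrA; apply; rewrite /= sm.
pose g : {linear E -> @mform R E m} := HB.pack A (GRing.isLinear.Build _ _ _ _ _ linA).
have contA : continuous A.
  have -> : A = g by [].
  apply/linear_bounded_continuous/linear_boundedP.
  near=> r => v; apply: (le_trans (boundA v)).
  by apply: ler_wpM2r => //; near: r; exact: nbhs_pinfty_ge.
have Ablin : A \in @blin R E (@mform R E m) by rewrite inE.
exists (BoundedLinear Ablin) => -[|v s]// [sm].
exact: evalA.
Unshelve. all: by end_near. Qed.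

Lemma mform_eval_slot (m : nat) (A : @mform R E m) s t :
  (size s + (size t).+1)%N = m -> linear (fun v => mform_eval A (s ++ v :: t)).
Proof.
elim: s m A => [|u s IH] [|m] A //= [sm]; last by move=> a v w; apply: IH.
by move=> a v w; rewrite blin_linear mform_eval_linear.
Qed.

Lemma map_nth_slot s t v (ti : seq nat) : size s \notin ti ->
  [seq (s ++ v :: t)`_i | i <- ti] = [seq (s ++ 0 :: t)`_i | i <- ti].
Proof.
move=> sti; apply/eq_in_map => i iti; rewrite !nth_cat; case: ltnP => // si.
have : i != size s by apply: contraNneq sti => <-.
by move: si; rewrite leq_eqVlt eq_sym => /orP[->//|]; rewrite -subn_gt0; case: (i - _)%N.
Qed.

Lemma mform_eval_select_slot (m : nat) (A : @mform R E m) s t (ti : seq nat) :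
  size ti = m -> uniq ti -> size s \in ti ->
  linear (fun v => mform_eval A [seq (s ++ v :: t)`_i | i <- ti]).
Proof.
move=> + + /splitPr sti; case: sti => a b abm; rewrite cat_uniq /= => /and3P[_].
rewrite negb_or => /andP[sa _] /andP[sb _].
have lA : linear (fun v => mform_eval A ([seq (s ++ 0 :: t)`_i | i <- a] ++ v ::
    [seq (s ++ 0 :: t)`_i | i <- b])).
  by apply: mform_eval_slot; rewrite !size_map -abm size_cat.
have -> // : (fun v => mform_eval A [seq (s ++ v :: t)`_i | i <- a ++ size s :: b]) =
   (fun v => mform_eval A ([seq (s ++ 0 :: t)`_i | i <- a] ++ v ::
    [seq (s ++ 0 :: t)`_i | i <- b])).
apply/funext => v; rewrite map_cat /= !(@map_nth_slot s t v)//.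
by rewrite nth_cat ltnn subnn.
Qed.

(** This bounds both the form that [mform_select] constructs and the bilinear
map that sends A and B to it. *)
Lemma mform_select_bound (p q m : nat) (A : @mform R E p) (B : @mform R E q)
    (ta tb : seq nat) s :
  size ta = p -> size tb = q -> perm_eq (ta ++ tb) (iota 0 m) -> size s = m ->
  `|mform_eval A [seq s`_i | i <- ta] * mform_eval B [seq s`_i | i <- tb]| <=
  `|A| * `|B| * \prod_(v <- s) `|v|.
Proof.
move=> tap tbq tab sm.
have -> : \prod_(v <- s) `|v| = \prod_(i <- ta ++ tb) `|s`_i|.
  by rewrite (perm_big _ tab) -[m]subn0 -/(index_iota _ _) -sm -(big_nth 0 xpredT).
rewrite big_cat normrM mulrACA.
apply: ler_pM => //.
  by have := @mform_eval_bound _ A [seq s`_i | i <- ta]; rewrite big_map size_map; apply.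
by have := @mform_eval_bound _ B [seq s`_i | i <- tb]; rewrite big_map size_map; apply.
Qed.

(** Distributing m arguments to two forms, according to lists of positions that
together use each position once, is again a form: the slot of a given argument
occurs in exactly one of the two factors. Besides the terms of the Leibniz rule
this covers products of homogeneous polynomials and, with a constant second
factor, permutations of the arguments. *)
Lemma mform_select (p q m : nat) (A : @mform R E p) (B : @mform R E q)
    (ta tb : seq nat) :
  size ta = p -> size tb = q -> perm_eq (ta ++ tb) (iota 0 m) ->
  exists C : @mform R E m, forall s, size s = m ->
    mform_eval C s =
    mform_eval A [seq s`_i | i <- ta] * mform_eval B [seq s`_i | i <- tb].
Proof.
move=> tap tbq tab; apply: (@mform_of_multilinear _ _ (`|A| * `|B|)) => [s t stm||s sm].
- have : uniq (ta ++ tb) by rewrite (perm_uniq tab) iota_uniq.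
  rewrite cat_uniq => /and3P[uta /hasPn tatb utb].
  have : size s \in ta ++ tb.
    by rewrite (perm_mem tab) mem_iota /= add0n -stm -addSnnS leq_addr.
  rewrite mem_cat => /orP[sta|stb] a u v.
    have stb : size s \notin tb by apply: contraL sta => /tatb.
    rewrite mform_eval_select_slot// !(@map_nth_slot s t _ tb)//.
    by rewrite mulrDl -mulrA.
  have sta : size s \notin ta by exact: tatb.
  rewrite [in X in _ * X]mform_eval_select_slot// !(@map_nth_slot s t _ ta)//.
  by rewrite mulrDr mulrCA.
- exact: mulr_ge0.
- exact: (mform_select_bound A B tap tbq tab sm).
Qed.

End MultilinearForms.

(** * Differentiability of bounded bilinear expressions *)

Section Differentiation.
Context {R : realType}.

(** The chosen differential depends on the whole function, so it has to be
identified again for g: the expansion of f at x is also one of g. *)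
Lemma near_eq_differentiable (U V : normedModType R) (f g : U -> V) (x : U) :
  {near x, f =1 g} -> differentiable f x -> differentiable g x.
Proof.
move=> fg /diff_locallyP[cdf fx].
have gx : g \o shift x = cst (g x) + 'd f x +o_ 0 id.
  apply/eqaddoP => e e0; move/eqaddoP/(_ _ e0): fx => fx.
  have fg0 : \forall h \near (0 : U), f (h + x) = g (h + x).
    by move: fg; rewrite (near_shift 0 x) subr0.
  have fgx : f x = g x by exact: nbhs_singleton fg.
  by apply: filterS2 fg0 fx => h; rewrite !fctE /= -fgx => ->.
by apply/diff_locallyP; rewrite (diff_unique cdf gx).
Qed.

Lemma differentiable_bounded_bilinear (X U V W : normedModType R)
    (mu : U -> V -> W) (f : X -> U) (g : X -> V) (x : X) :
  (forall v, linear (mu ^~ v)) -> (forall u, linear (mu u)) ->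
  (forall u v, `|mu u v| <= `|u| * `|v|) ->
  differentiable f x -> differentiable g x ->
  differentiable (fun y => mu (f y) (g y)) x.
Proof.
move=> mul mur mub df dg.
have mubil : bilinear_for
    (GRing.Scale.Law.clone _ _ *:%R _) (GRing.Scale.Law.clone _ _ *:%R _) mu.
  by split=> [v|u] a b c /=; [exact: mul|exact: mur].
pose muB : {bilinear U -> V -> W} := HB.pack mu
  (bilinear_isBilinear.Build R U V W _ _ mu mubil).
have muc : continuous (fun p : U * V => muB p.1 p.2).
  move=> [u v]; apply/subr_cvg0.
  have h0 : `|p.1 - u| * `|p.2| + `|u| * `|p.2 - v| @[p --> (u, v)] --> (0 : R^o).
    have c1 : p.1 - u @[p --> (u, v)] --> 0.
      by apply/subr_cvg0; exact: cvg_fst.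
    have c2 : p.2 - v @[p --> (u, v)] --> 0.
      by apply/subr_cvg0; exact: cvg_snd.
    have -> : (0 : R) = `|0 : U| * `|v| + `|u| * `|0 : V|.
      by rewrite !normr0 mul0r mulr0 addr0.
    apply: cvgD; apply: cvgM; try exact: cvg_cst.
    - exact: cvg_norm c1.
    - by apply: cvg_norm; exact: cvg_snd.
    - exact: cvg_norm c2.
  apply/norm_cvg0P; apply: (squeeze_cvgr _ (cvg_cst (0 : R)) h0).
  near=> p; rewrite normr_ge0 /=.
  have -> : muB p.1 p.2 - muB u v = muB (p.1 - u) p.2 + muB u (p.2 - v).
    by rewrite linearBl linearBr addrA subrK.
  by rewrite (le_trans (ler_normD _ _))// lerD.
have := differentiable_comp (differentiable_pair df dg)
  (@differentiable_bilin _ _ _ _ muB (f x, g x) muc).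
exact.
Unshelve. all: by end_near. Qed.

End Differentiation.

(** * Words and the distribution of arguments *)

Section Words.
Context {I : finType}.

(** With w a word whose letters name the recipients of the entries of s, this is
the list of the entries that the recipient i gets, in their order. *)
Definition subword (T : Type) (w : seq I) (i : I) (s : seq T) : seq T :=
  mask [seq j == i | j <- w] s.

Lemma big_tuple_cons (A : nmodType) (k : nat) (F : k.+1.-tuple I -> A) :
  \sum_w F w = \sum_(w : k.-tuple I) \sum_i F [tuple of i :: w].
Proof.
rewrite exchange_big pair_big /=.
rewrite (reindex (fun p : I * k.-tuple I => [tuple of p.1 :: p.2]))//.
exists (fun w : k.+1.-tuple I => (thead w, [tuple of behead w])) => [[i w]|w] _ /=.
  by congr pair; apply/val_inj.
by rewrite [RHS]tuple_eta.
Qed.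

(** The combinatorial heart of the Leibniz rule: the first letter of a word says
which of the factors receives the new argument u. Applied with a i s either
a derivative in the directions s or a formal derivative of order the length of
s, the right-hand side is what the product rule produces. *)
Lemma sum_subword_cons (A : comPzRingType) (T : Type) (a : I -> seq T -> A)
    (u : T) (s : seq T) :
  \sum_(w : (size s).+1.-tuple I) \prod_i a i (subword w i (u :: s)) =
  \sum_(w : (size s).-tuple I) \sum_i
    a i (u :: subword w i s) * \prod_(j | j != i) a j (subword w j s).
Proof.
rewrite big_tuple_cons; apply: eq_bigr => w _; apply: eq_bigr => i _.
rewrite (bigD1 i)//= /subword /= eqxx; congr (_ * _).
by apply: eq_bigr => j ji; rewrite eq_sym (negbTE ji).
Qed.

Lemma size_subword (T : Type) (w : seq I) (i : I) (s : seq T) :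
  size s = size w -> size (subword w i s) = count_mem i w.
Proof. by move=> sw; rewrite size_mask ?size_map// count_map. Qed.

Lemma map_nth_subword (T : Type) (x0 : T) (w : seq I) i (s : seq T) k :
  size s = k -> [seq nth x0 s j | j <- subword w i (iota 0 k)] = subword w i s.
Proof. by move=> <-; rewrite /subword map_mask map_nth_iota0// take_size. Qed.

Lemma subword_nseq (T : Type) (w : seq I) i (u : T) l :
  size w = l -> subword w i (nseq l u) = nseq (count_mem i w) u.
Proof.
by move=> <-; rewrite /subword; elim: w => //= j w IH; case: (j == i); rewrite IH.
Qed.

End Words.

Lemma perm_subword_bool (T : eqType) (w : seq bool) (s : seq T) :
  size s = size w -> perm_eq (subword w true s ++ subword w false s) s.
Proof.
elim: w s => [|b w IH] [|u s]//= [sw].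
case: b; rewrite /subword /=; first by rewrite perm_cons; exact: IH.
by rewrite -[u :: _ in X in perm_eq X]cat1s perm_catCA perm_cons; exact: IH.
Qed.

(** * The Leibniz rule *)

Section HigherOrder.
Context {R : realType} {E : normedModType R}.
Implicit Types (f g : E -> R) (x u : E) (s : seq E).

Lemma fdifferentiable_le j k f x :
  (j <= k)%N -> fdifferentiable k f x -> fdifferentiable j f x.
Proof.
elim: k => [|k IH]; first by rewrite leqn0 => /eqP->.
rewrite leq_eqVlt => /orP[/eqP->//|jk] [fk _].
by apply: IH => //; exact: nbhs_singleton fk.
Qed.

Lemma fderivE (F : normedModType R) (h : E -> F) x :
  differentiable h x -> fderiv h x = 'd h x :> (E -> F).
Proof.
move=> dh; rewrite /fderiv; apply: insubdK.
by rewrite inE; split; [exact: linearP|exact: diff_continuous].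
Qed.

(** Evaluation of a form at fixed arguments is linear and bounded, so it commutes
with differentiation; this reduces identities between higher derivatives to
real-valued directional derivatives. *)
Lemma is_derive_D f x u s : fdifferentiable (size s).+1 f x ->
  is_derive x u (fun y => D f y s) (D f x (u :: s)).
Proof.
move=> [_ df].
pose ev : {linear @mform R E (size s) -> R} := HB.pack
  (fun A : @mform R E (size s) => mform_eval A s)
  (GRing.isLinear.Build _ _ _ _ _ (mform_eval_linear s)).
have cev : continuous ev.
  apply/linear_bounded_continuous/linear_boundedP; near=> r => A.
  apply: (le_trans (mform_eval_bound A erefl)); rewrite mulrC.
  by apply: ler_wpM2r => //; near: r; exact: nbhs_pinfty_ge.
have dev : differentiable ev (fderivn (size s) f x) by exact: linear_differentiable.
have dD := differentiable_comp df dev.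
apply: DeriveDef; first exact: diff_derivable dD.
have -> : (fun y => D f y s) = ev \o fderivn (size s) f by [].
by rewrite deriveE// diff_comp// diff_lin//= /D /= fderivE.
Unshelve. all: by end_near. Qed.

End HigherOrder.

Section Leibniz.
Context {R : realType} {E : normedModType R}.
Implicit Types (f g : E -> R) (x u : E) (s : seq E).

Lemma is_derive_bigsum (J : Type) (r : seq J) (h : J -> E -> R) (dh : J -> R) x u :
  (forall j, is_derive x u (h j) (dh j)) ->
  is_derive x u (fun y => \sum_(j <- r) h j y) (\sum_(j <- r) dh j).
Proof.
move=> dhj; elim: r => [|j r IH].
  rewrite big_nil; apply: near_eq_is_derive (is_derive_cst (0 : R) x u).
  by near=> y; rewrite big_nil.
rewrite big_cons; apply: near_eq_is_derive (is_deriveD (dhj j) IH).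
by near=> y; rewrite big_cons.
Unshelve. all: by end_near. Qed.

Lemma is_derive_bigprod (J : eqType) (r : seq J) (h : J -> E -> R) (dh : J -> R) x u :
  uniq r -> (forall j, is_derive x u (h j) (dh j)) ->
  is_derive x u (fun y => \prod_(j <- r) h j y)
    (\sum_(j <- r) dh j * \prod_(i <- r | i != j) h i x).
Proof.
move=> + dhj; elim: r => [_|j r IH /= /andP[jr ur]].
  rewrite big_nil; apply: near_eq_is_derive (is_derive_cst (1 : R) x u).
  by near=> y; rewrite big_nil.
have dM := is_deriveM (dhj j) (IH ur).
apply: is_derive_eq.
  by apply: near_eq_is_derive dM; near=> y; rewrite big_cons.
rewrite addrC !big_cons eqxx /=; congr (_ + _).
  rewrite /GRing.scale /= mulrC; congr (_ * _).
  rewrite big_seq_cond [RHS]big_seq_cond; apply: eq_bigl => i.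
  by case: (boolP (i \in r)) => //= ir; apply/esym; apply: contraNneq jr => <-.
rewrite /GRing.scale /= mulr_sumr; apply: eq_big_seq => i ir.
rewrite big_cons ifT; first by rewrite mulrCA.
by apply: contraNneq jr => ->.
Unshelve. all: by end_near. Qed.

(** Differentiability of the product is assumed here, so that this rule, used at
points near x, can serve in turn to prove it; see [fdifferentiableM]. *)
Lemma D_prod (I : finType) (f : I -> E -> R) k x s :
  (forall i, fdifferentiable k (f i) x) ->
  fdifferentiable k (fun y => \prod_i f i y) x -> size s = k ->
  D (fun y => \prod_i f i y) x s =
  \sum_(w : k.-tuple I) \prod_i D (f i) x (subword w i s).
Proof.
elim: k x s => [|k IH] x s fk pk.
  move=> /size0nil ->; rewrite (big_pred1 [tuple]); last by move=> w; apply/esym/eqP; exact: tuple0.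
  by apply: eq_bigr => i _; rewrite /subword mask0.
case: s => [//|u s] [sk]; move: IH fk pk; rewrite -{}sk => IH fk pk.
have dl : is_derive x u (fun y => D (fun y => \prod_i f i y) y s)
    (D (fun y => \prod_i f i y) x (u :: s)) by exact: is_derive_D.
pose S y := \sum_(w : (size s).-tuple I) \prod_i D (f i) y (subword w i s).
have nearS : \near x, D (fun y => \prod_i f i y) x s = S x.
  have nf : \near x, forall i, fdifferentiable (size s) (f i) x.
    by apply: filter_forall => i; case: (fk i).
  case: pk => np _.
  by apply: filterS2 nf np => y fy py; apply: IH.
have dr : is_derive x u S (\sum_(w : (size s).-tuple I) \sum_i
    D (f i) x (u :: subword w i s) * \prod_(j | j != i) D (f j) x (subword w j s)).
  apply: is_derive_bigsum => w; apply: is_derive_bigprod => [|i].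
    exact: index_enum_uniq.
  apply: is_derive_D; apply: fdifferentiable_le (fk i).
  by rewrite ltnS size_subword ?size_tuple// -[leqRHS](size_tuple w) count_size.
rewrite (sum_subword_cons (fun i => D (f i) x)) -(derive_val (is_derive := dl)).
by rewrite (near_eq_derive u nearS) (derive_val (is_derive := dr)).
Qed.

End Leibniz.

(** * Higher differentiability of products *)

Section ProductDifferentiability.
Context {R : realType} {E : normedModType R}.
Implicit Types (f g : E -> R) (x u : E) (s : seq E).

(** The form H y of [mform_select] depends on F y and G y in a bilinear way, since
forms are determined by their values, and with the bound of
[mform_select_bound]. *)
Lemma differentiable_mform_select (p q m : nat) (F : E -> @mform R E p)
    (G : E -> @mform R E q) (ta tb : seq nat) x :
  size ta = p -> size tb = q -> perm_eq (ta ++ tb) (iota 0 m) ->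
  differentiable F x -> differentiable G x ->
  exists2 H : E -> @mform R E m, differentiable H x &
    forall y s, size s = m -> mform_eval (H y) s =
      mform_eval (F y) [seq s`_i | i <- ta] * mform_eval (G y) [seq s`_i | i <- tb].
Proof.
move=> tap tbq tab dF dG.
have /choice[mu' mu'P] : forall AB : @mform R E p * @mform R E q,
    exists C : @mform R E m, forall s, size s = m -> mform_eval C s =
      mform_eval AB.1 [seq s`_i | i <- ta] * mform_eval AB.2 [seq s`_i | i <- tb].
  by move=> [A B]; exact: mform_select.
pose mu A B := mu' (A, B).
have muP A B s : size s = m -> mform_eval (mu A B) s =
   mform_eval A [seq s`_i | i <- ta] * mform_eval B [seq s`_i | i <- tb].
  by move=> sm; rewrite mu'P.
exists (fun y => mu (F y) (G y)); last by move=> y s; exact: muP.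
apply: differentiable_bounded_bilinear => //.
- move=> B a A A'; apply: mform_ext => s sm.
  by rewrite mform_eval_linear !muP// mform_eval_linear mulrDl -scalerAl.
- move=> A a B B'; apply: mform_ext => s sm.
  by rewrite mform_eval_linear !muP// mform_eval_linear mulrDr -scalerAr.
- move=> A B; apply: mform_norm_le => [|s sm]; first exact: mulr_ge0.
  by rewrite muP//; exact: (mform_select_bound A B tap tbq tab sm).
Qed.

Lemma differentiable_bigsum (J : Type) (r : seq J) (V : normedModType R)
    (h : J -> E -> V) x :
  (forall j, differentiable (h j) x) ->
  differentiable (fun y => \sum_(j <- r) h j y) x.
Proof.
move=> dh; elim: r => [|j r IH].
  by have -> : (fun y => \sum_(j <- [::]) h j y) = cst 0
    by apply/funext => y; rewrite big_nil.
have -> : (fun y => \sum_(j <- j :: r) h j y) = h j + (fun y => \sum_(j <- r) h j y).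
  by apply/funext => y; rewrite big_cons.
exact: differentiableD.
Qed.

Lemma fderivn_differentiable j k f x : (j < k)%N -> fdifferentiable k f x ->
  differentiable (fderivn j f) x.
Proof. by move=> jk /(fdifferentiable_le jk)[]. Qed.

(** By induction the product is k times differentiable near x, hence its k-th
derivative is given there by [D_prod] over the booleans; each of the finitely
many terms involves derivatives of order at most k of f and g, which are
differentiable at x. *)
Lemma fdifferentiableM k f g x : fdifferentiable k f x -> fdifferentiable k g x ->
  fdifferentiable k (fun y => f y * g y) x.
Proof.
elim: k x => [//|k IH] x fk gk.
have nfg : \forall y \near x, fdifferentiable k f y /\ fdifferentiable k g y.
  by case: fk => nf _; case: gk => ng _; exact: filterS2 nf ng.
split; first by apply: filterS nfg => y [fy gy]; exact: IH.
have /choice[H HP] : forall w : k.-tuple bool, exists H : E -> @mform R E k,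
    differentiable H x /\ forall y s, size s = k -> mform_eval (H y) s =
      D f y (subword w true s) * D g y (subword w false s).
  move=> w; have sw b (s : seq E) : size s = k -> size (subword w b s) = count_mem b w.
    by move=> sk; rewrite size_subword// size_tuple.
  have wk b : (count_mem b w < k.+1)%N by rewrite ltnS -[leqRHS](size_tuple w) count_size.
  have [|||||H dH HE] := @differentiable_mform_select (count_mem true w)
      (count_mem false w) k (fderivn _ f) (fderivn _ g)
      (subword w true (iota 0 k)) (subword w false (iota 0 k)) x.
  - by rewrite size_subword// size_iota size_tuple.
  - by rewrite size_subword// size_iota size_tuple.
  - by apply: perm_subword_bool; rewrite size_iota size_tuple.
  - exact: fderivn_differentiable (wk _) fk.
  - exact: fderivn_differentiable (wk _) gk.
  exists H; split=> // y s sk; rewrite HE// /D !sw//.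
  by rewrite !(map_nth_subword _ _ _ sk).
apply: (@near_eq_differentiable _ _ _ (fun y => \sum_w H w y)); last first.
  by apply: differentiable_bigsum => w; case: (HP w).
apply: filterS nfg => y [fy gy]; apply: mform_ext => s sk.
pose fg b := if b then f else g.
have fgE : (fun y => f y * g y) = (fun y => \prod_b fg b y).
  by apply/funext => z; rewrite big_bool.
have -> : mform_eval (fderivn k (fun z => f z * g z) y) s = D (fun y => f y * g y) y s.
  by rewrite /D sk.
rewrite fgE (D_prod _ _ sk); last first.
- by rewrite -fgE; exact: IH.
- by case.
rewrite mform_eval_sum; apply: eq_bigr => w _.
by rewrite big_bool (HP w).2.
Qed.

Lemma fdifferentiable_cst k (c : R) x : fdifferentiable k (fun=> c : R) x.
Proof.
have derivn_cst m : exists a, fderivn m (fun=> c : R) = cst a :> (E -> @mform R E m).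
  elim: m => [|m [a IH]]; first by exists c.
  exists (insubd 0 (0 : E -> @mform R E m)); apply/funext => y /=.
  rewrite IH /fderiv; congr (insubd _ _).
  exact: diff_cst.
elim: k x => [//|k IH] x; split; first exact: nearW.
by have [a ->] := derivn_cst k; exact: differentiable_cst.
Qed.

Lemma fdifferentiable_prod k (J : Type) (r : seq J) (f : J -> E -> R) x :
  (forall j, fdifferentiable k (f j) x) ->
  fdifferentiable k (fun y => \prod_(j <- r) f j y) x.
Proof.
move=> fk; elim: r => [|j r IH].
  under eq_fun do rewrite big_nil; exact: fdifferentiable_cst.
under eq_fun do rewrite big_cons; exact: fdifferentiableM.
Qed.

End ProductDifferentiability.

(** * Polynomial maps and their components *)

Lemma map_nth_nseq (T : Type) (x0 v : T) (m : nat) (p : seq nat) :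
  all (fun i => i < m)%N p -> [seq nth x0 (nseq m v) i | i <- p] = nseq (size p) v.
Proof. by elim: p => //= i p IH /andP[im /IH ->]; rewrite nth_nseq im. Qed.

Section Symmetrization.
Context {R : realType} {E : normedModType R}.
Implicit Types (v : E) (s t : seq E).

(** An injective self-map of a finite set is a bijection: the list on the left is
free of duplicates, consists of permutations and has the right length. *)
Lemma perm_permutations_comp (m : nat) (r : seq nat) : perm_eq r (iota 0 m) ->
  perm_eq [seq [seq nth 0%N r i | i <- p] | p <- permutations (iota 0 m)]
          (permutations (iota 0 m)).
Proof.
move=> rm; have ur : uniq r by rewrite (perm_uniq rm) iota_uniq.
have szr : size r = m by rewrite (perm_size rm) size_iota.
have lt_m p i : p \in permutations (iota 0 m) -> i \in p -> (i < m)%N.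
  by rewrite mem_permutations => /perm_mem ->; rewrite mem_iota.
have u1 : uniq [seq [seq nth 0%N r i | i <- p] | p <- permutations (iota 0 m)].
  rewrite map_inj_in_uniq ?permutations_uniq// => p p' pP p'P.
  move=> /(congr1 (map (index^~ r))); rewrite -!map_comp.
  rewrite map_id_in => [->|i ip].
    by rewrite map_id_in// => i ip /=; rewrite index_uniq// szr (lt_m p').
  by rewrite /= index_uniq// szr (lt_m p).
apply: uniq_perm => //; first exact: permutations_uniq.
set q := [seq _ | p <- _] in u1 *.
have sub : {subset q <= permutations (iota 0 m)}.
  move=> _ /mapP[p + ->]; rewrite !mem_permutations => pm.
  by rewrite (perm_trans (perm_map _ pm))// -szr map_nth_iota0// take_size szr.
by apply: (uniq_min_size u1 sub _).2; rewrite size_map.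
Qed.

(** The sum over all rearrangements of the arguments is symmetric, and on the
diagonal all its terms agree. *)
Lemma symmetrization (m : nat) (A : @mform R E m) :
  exists2 S : @mform R E m, symmetric_mform S &
    forall v, mform_eval S (nseq m v) = m`!%:R * mform_eval A (nseq m v).
Proof.
have /choice[B BP] : forall p : seq nat, exists B : @mform R E m,
    perm_eq p (iota 0 m) -> forall s, size s = m ->
      mform_eval B s = mform_eval A [seq s`_i | i <- p].
  move=> p; case: (boolP (perm_eq p (iota 0 m))) => [pm|_]; last by exists A.
  have szp : size p = m by rewrite (perm_size pm) size_iota.
  have [|B BE] := @mform_select _ _ m 0 m A (1 : R) p [::] szp erefl.
    by rewrite cats0.
  by exists B => _ s sm; rewrite BE// mulr1.
have BE s : size s = m -> mform_eval (\sum_(p <- permutations (iota 0 m)) B p) s =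
    \sum_(p <- permutations (iota 0 m)) mform_eval A [seq s`_i | i <- p].
  move=> sm; rewrite mform_eval_sum; apply: eq_big_seq => p.
  by rewrite mem_permutations => pm; exact: BP.
exists (\sum_(p <- permutations (iota 0 m)) B p).
  move=> s t sm st; have tm : size t = m by rewrite -(perm_size st).
  rewrite !BE//; have /(perm_iotaP 0)[r] := st; rewrite /= tm => rm ->.
  have rszm : size r = m by rewrite (perm_size rm) size_iota.
  rewrite -[RHS](perm_big _ (perm_permutations_comp rm)) big_map /=.
  apply: eq_big_seq => p; rewrite mem_permutations => pm; congr mform_eval.
  rewrite -map_comp; apply/eq_in_map => i /=.
  by rewrite (perm_mem pm) mem_iota /= add0n => im; rewrite (nth_map 0%N) ?rszm.
move=> v; rewrite BE ?size_nseq//.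
transitivity (\sum_(p <- permutations (iota 0 m)) mform_eval A (nseq m v)).
  apply: eq_big_seq => p; rewrite mem_permutations => pm; congr mform_eval.
  rewrite map_nth_nseq ?(perm_size pm) ?size_iota//.
  by apply/allP => i; rewrite (perm_mem pm) mem_iota.
by rewrite big_const_seq count_predT size_permutations ?iota_uniq// size_iota
  iter_addr_0 mulr_natl.
Qed.

End Symmetrization.

Section HomogeneousPolynomials.
Context {R : realType} {E : normedModType R}.
Implicit Types (v : E) (q : E -> R).

(** Symmetry is left out because distributing arguments to two symmetric forms
does not preserve it; [form_poly_homogeneous] restores it. *)
Definition form_poly (j : nat) (q : E -> R) : Prop :=
  exists A : @mform R E j, forall v, q v = mform_eval A (nseq j v).

Lemma form_poly_homogeneous j q : form_poly j q -> homogeneous_poly j q.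
Proof.
move=> [A qA]; have [S symS SA] := symmetrization A.
exists S => // v; rewrite SA qA mulKf// pnatr_eq0 -lt0n; exact: fact_gt0.
Qed.

Lemma form_poly_scale (c : R) j (A : @mform R E j) :
  form_poly j (fun v => c * mform_eval A (nseq j v)).
Proof.
by exists (c *: A) => v; rewrite mform_evalZ.
Qed.

Lemma form_poly0 j : form_poly j ((fun=> 0) : E -> R).
Proof. by exists 0 => v; rewrite mform_eval0. Qed.

Lemma form_poly_sum (J : Type) (r : seq J) (q : J -> E -> R) j :
  (forall a, form_poly j (q a)) -> form_poly j (fun v => \sum_(a <- r) q a v).
Proof.
move=> /choice[A qA]; exists (\sum_(a <- r) A a) => v.
by rewrite mform_eval_sum; apply: eq_bigr => a _.
Qed.

Lemma form_polyM i j q q' : form_poly i q -> form_poly j q' ->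
  form_poly (i + j) (fun v => q v * q' v).
Proof.
move=> [A qA] [B qB].
have [|C CE] := @mform_select _ _ i j (i + j) A B (iota 0 i) (iota i j)
  (size_iota _ _) (size_iota _ _); first by rewrite iotaD.
exists C => v; rewrite CE ?size_nseq// qA qB.
rewrite !map_nth_nseq ?size_iota//; apply/allP => a; rewrite mem_iota => /andP[] // _.
exact: ltn_addr.
Qed.

Lemma mform_eval_nseqZ (j : nat) (A : @mform R E j) (a : R) v :
  mform_eval A (nseq j (a *: v)) = a ^+ j * mform_eval A (nseq j v).
Proof.
elim: j A => [|j IH] A /=; first by rewrite expr0 mul1r.
rewrite IH blinZ exprSr -mulrA; congr (_ * _).
exact: mform_evalZ.
Qed.

Lemma poly_eq_horner (P Q : {poly R}) : (forall a, P.[a] = Q.[a]) -> P = Q.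
Proof.
move=> PQ; apply/eqP; rewrite -subr_eq0; apply/negPn/negP => PQ0.
(* The images of the first natural numbers are too many roots for P - Q. *)
pose r := [seq i%:R | i <- iota 0 (size (P - Q))] : seq R.
suff : (size r < size (P - Q)%R)%N by rewrite size_map size_iota ltnn.
apply: max_poly_roots => //.
  by apply/allP => a _; rewrite rootE !hornerE PQ subrr.
by rewrite map_inj_uniq ?iota_uniq// => i j /eqP; rewrite eqr_nat => /eqP.
Qed.

(** Along the line through v, the components are the coefficients of a
univariate polynomial whose value at a is p (a v), and a polynomial over an
infinite field is determined by its values. *)
Lemma poly_components_inj p (q q' : nat -> E -> R) :
  poly_components p q -> poly_components p q' -> q = q'.
Proof.
have tpoly (q1 : nat -> E -> R) : poly_components p q1 -> forall v, exists2 P : {poly R},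
    forall a, P.[a] = p (a *: v) & forall j, P`_j = q1 j v.
  move=> [hq1 [N [q0 pq]]] v; exists (\poly_(j < N) q1 j v) => [a|j].
    rewrite horner_poly pq; apply: eq_bigr => j _.
    have [A _ qA] := hq1 j.
    by rewrite !qA mform_eval_nseqZ mulrAC -mulrA [_ ^+ _ * _]mulrC mulrA.
  by rewrite coef_poly; case: ltnP => // /q0 ->.
move=> pq pq'; apply/funext => j; apply/funext => v.
have [P Pp <-] := tpoly _ pq v; have [P' P'p <-] := tpoly _ pq' v.
by have -> // : P = P'; apply: poly_eq_horner => a; rewrite Pp P'p.
Qed.

Lemma poly_componentE p (q : nat -> E -> R) : poly_components p q -> poly_component p = q.
Proof.
by move=> pq; apply: (poly_components_inj (xgetPex 0 (ex_intro _ q pq)) pq).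
Qed.

End HomogeneousPolynomials.

(** * Taylor polynomials of products *)

Section TaylorPolynomial.
Context {R : realType} {E : normedModType R}.
Implicit Types (f : E -> R) (x v : E).

(** The Taylor polynomial along the line a |-> x + a v, kept as a formal
polynomial in a so that its coefficients can be read off. *)
Definition taylor_line (k : nat) f x v : {poly R} :=
  \poly_(l < k.+1) ((l`!%:R)^-1 * D f x (nseq l v)).

Lemma D_nseq f x l v : D f x (nseq l v) = mform_eval (fderivn l f x) (nseq l v).
Proof. by rewrite /D size_nseq. Qed.

Lemma horner_taylor_line k f x v a :
  (taylor_line k f x v).[a] = taylor k f x (a *: v).
Proof.
rewrite horner_poly; apply: eq_bigr => l _; rewrite !D_nseq mform_eval_nseqZ.
by rewrite -mulrA; congr (_ * _); rewrite mulrC.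
Qed.

Lemma deriv_prod (I : finType) (P : I -> {poly R}) :
  (\prod_i P i)^`() = \sum_i (P i)^`() * \prod_(j | j != i) P j.
Proof.
have gen (r : seq I) : uniq r -> (\prod_(i <- r) P i)^`() =
    \sum_(i <- r) (P i)^`() * \prod_(j <- r | j != i) P j.
  elim: r => [_|i r IH /= /andP[ir ur]]; first by rewrite !big_nil -polyC1 derivC.
  rewrite !big_cons derivM IH// eqxx /=; congr (_ + _).
    congr (_ * _); rewrite big_seq_cond [RHS]big_seq_cond; apply: eq_bigl => j.
    by case: (boolP (j \in r)) => //= jr; apply/esym; apply: contraNneq ir => <-.
  rewrite mulr_sumr; apply: eq_big_seq => j jr.
  by rewrite big_cons ifT 1?mulrCA//; apply: contraNneq ir => ->.
exact/gen/index_enum_uniq.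
Qed.

Lemma derivn_prod (I : finType) (P : I -> {poly R}) (l : nat) :
  (\prod_i P i)^`(l) = \sum_(w : l.-tuple I) \prod_i (P i)^`(count_mem i w).
Proof.
(* Only the number of arguments given to each factor matters, so the unit type will
   do as the type of arguments. *)
pose a i (s : seq unit) := (P i)^`(size s).
have sz m (w : m.-tuple I) i : size (subword w i (nseq m tt)) = count_mem i w.
  by rewrite size_subword// size_nseq size_tuple.
suff -> : (\prod_i P i)^`(l) =
    \sum_(w : l.-tuple I) \prod_i a i (subword w i (nseq l tt)).
  by apply: eq_bigr => w _; apply: eq_bigr => i _; rewrite /a sz.
elim: l => [|l IH].
  rewrite (big_pred1 [tuple]); last by move=> w; apply/esym/eqP; exact: tuple0.
  by apply: eq_bigr => i _; rewrite /a /subword mask0.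
have := sum_subword_cons a tt (nseq l tt); rewrite size_nseq /= => ->.
rewrite IH raddf_sum; apply: eq_bigr => w _; rewrite /= deriv_prod.
by apply: eq_bigr => i _; congr (_ * _).
Qed.

(** Up to the factor l!, both sides are the same sum over words of length l: on
the left because the coefficient of order l of a polynomial is its l-th
derivative at 0 divided by l!, and on the right by [D_prod]. Truncation at order
k is harmless since a letter occurs at most l <= k times in such a word. *)
Lemma coef_prod_taylor_line (I : finType) (f : I -> E -> R) k x v l :
  (forall i, fdifferentiable k (f i) x) -> (l <= k)%N ->
  (\prod_i taylor_line k (f i) x v)`_l =
  (l`!%:R)^-1 * D (fun y => \prod_i f i y) x (nseq l v).
Proof.
move=> fk lk; have fl i := fdifferentiable_le lk (fk i).
have lneq0 m : (m`!%:R : R) != 0 by rewrite pnatr_eq0 -lt0n fact_gt0.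
apply: (mulfI (lneq0 l)); rewrite mulVKf//.
transitivity ((\prod_i taylor_line k (f i) x v)^`(l)`_0).
  by rewrite coef_derivn addn0 ffactnn mulr_natl.
rewrite (D_prod fl (fdifferentiable_prod _ fl) (size_nseq _ _)).
rewrite derivn_prod coef_sum; apply: eq_bigr => w _.
rewrite -horner_coef0 horner_prod; apply: eq_bigr => i _.
rewrite horner_coef0 coef_derivn addn0 ffactnn coef_poly ifT; last first.
  by rewrite ltnS (leq_trans _ lk)// -[leqRHS](size_tuple w) count_size.
rewrite -[LHS]mulr_natl mulVKf//.
by rewrite (subword_nseq _ _ (size_tuple w)).
Qed.

Lemma coef_prod_form_poly (I : Type) (r : seq I) (P : I -> E -> {poly R}) j :
  (forall i l, form_poly l (fun v => (P i v)`_l)) ->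
  form_poly j (fun v => (\prod_(i <- r) P i v)`_j).
Proof.
move=> hP; elim: r j => [|i r IH] j.
  under eq_fun do rewrite big_nil coef1.
  by case: j => [|j]; [exists (1 : R) | exact: form_poly0].
under eq_fun do rewrite big_cons coefM.
apply: form_poly_sum => a.
by have := form_polyM (hP i a) (IH (j - a)%N); rewrite subnKC// -ltnS.
Qed.

(** The coefficients are polynomial in v by [coef_prod_form_poly], and their sum
is the value at 1 of the product of the [taylor_line]s. *)
Lemma prod_taylor_components (I : finType) (f : I -> E -> R) k x :
  poly_components (fun v => \prod_i taylor k (f i) x v)
    (fun j v => (\prod_i taylor_line k (f i) x v)`_j).
Proof.
split=> [j|].
  apply: form_poly_homogeneous; apply: coef_prod_form_poly => i l.
  under eq_fun do rewrite coef_poly D_nseq.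
  by case: ltnP => _; [exact: form_poly_scale|exact: form_poly0].
pose N := (\sum_(i : I) k.+1).+1.
have sizeN v : (size (\prod_i taylor_line k (f i) x v)%R <= N)%N.
  apply: leq_trans (size_poly_prod_leq _ _) _; apply: leq_trans (leq_subr _ _) _.
  by rewrite ltnS; apply: leq_sum => i _; exact: size_poly.
exists N; split=> [j Nj|v].
  by apply/funext => v; rewrite nth_default// (leq_trans (sizeN v)).
under eq_bigr do rewrite -[v in taylor _ _ _ v]scale1r -horner_taylor_line.
rewrite -horner_prod (horner_coef_wide _ (sizeN v)).
by apply: eq_bigr => j _; rewrite expr1n mulr1.
Qed.

Lemma taylor_prod (I : finType) (f : I -> E -> R) k x v :
  (forall i, fdifferentiable k (f i) x) ->
  taylor k (fun y => \prod_i f i y) x v =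
  poly_trunc k (fun w => \prod_i taylor k (f i) x w) v.
Proof.
move=> fk; rewrite /poly_trunc (poly_componentE (prod_taylor_components f k x)).
by apply: eq_bigr => l _; rewrite coef_prod_taylor_line// -ltnS.
Qed.

End TaylorPolynomial.

(** * Multi-indices and partial derivatives *)

Section MultiIndices.
Context {R : realType} {d : nat}.
Implicit Types (v : 'rV[R]_d) (nu : mpoly.multinom d).

Lemma mi_powD v nu nu' : mi_pow v (mpoly.mnm_add nu nu') = mi_pow v nu * mi_pow v nu'.
Proof. by rewrite -big_split; apply: eq_bigr => i _; rewrite mpoly.mnmDE exprD. Qed.

Lemma mi_pow0 v : mi_pow v mpoly.mnm0 = 1.
Proof. by apply: big1 => i _; rewrite mpoly.mnm0E. Qed.

Lemma mi_pow1 v i : mi_pow v (mpoly.mnm1 i) = v ord0 i.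
Proof.
rewrite /mi_pow (bigD1 i)//= big1 => [|j ji]; first by rewrite mpoly.mnm1E eqxx mulr1.
by rewrite mpoly.mnm1E eq_sym (negbTE ji).
Qed.

Lemma mi_powZ (a : R) v nu : mi_pow (a *: v) nu = a ^+ mpoly.mdeg nu * mi_pow v nu.
Proof.
rewrite mpoly.mdegE expr_sum -big_split; apply: eq_bigr => i _.
by rewrite mxE exprMn.
Qed.

Lemma mi_fact_neq0 nu : mi_fact nu != 0 :> R.
Proof. by rewrite pnatr_eq0 -lt0n prodn_gt0// => i; exact: fact_gt0. Qed.

(** Uniqueness of the expansion in base K. *)
Lemma digits_inj (m K : nat) (a b : 'I_m -> nat) :
  (forall i, a i < K)%N -> (forall i, b i < K)%N ->
  (\sum_i a i * K ^ i = \sum_i b i * K ^ i)%N -> a =1 b.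
Proof.
elim: m a b => [|m IH] a b aK bK; first by move=> _ [].
have split_digit (c : 'I_m.+1 -> nat) :
    (\sum_i c i * K ^ i = (\sum_i c (lift ord0 i) * K ^ i) * K + c ord0)%N.
  rewrite big_ord_recl expn0 muln1 addnC big_distrl /=; congr addn.
  by apply: eq_bigr => i _; rewrite -mulnA -expnSr.
rewrite !split_digit => ab.
have ab0 : a ord0 = b ord0.
  by have := congr1 (modn^~ K) ab; rewrite /= !modnMDl !modn_small.
have K0 : (0 < K)%N by apply: leq_ltn_trans (aK ord0).
have abl : a \o lift ord0 =1 b \o lift ord0.
  apply: IH => [i|i|]; [exact: aK|exact: bK|].
  by apply/eqP; rewrite -(eqn_pmul2r K0) -(eqn_add2r (a ord0)) {2}ab0; apply/eqP.
by move=> i; case: (unliftP ord0 i) => [j|] ->//; exact: abl.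
Qed.

(** Kronecker substitution: for v_i = t ^ (K ^ i) the monomial v^nu becomes a
power of t whose exponent has the entries of nu as its digits in base K, so
distinct multi-indices give distinct powers. *)
Lemma mi_pow_free (K : nat) (a : mpoly.bmultinom d K -> R) :
  (forall v, \sum_(nu : mpoly.bmultinom d K) mi_pow v nu * a nu = 0) ->
  forall nu : mpoly.bmultinom d K, a nu = 0.
Proof.
move=> a0 nu; pose code (nu : mpoly.multinom d) := (\sum_i nu i * K ^ i)%N.
have nuK (mu : mpoly.bmultinom d K) i : (mpoly.bmnm mu i < K)%N.
  apply: leq_ltn_trans (mpoly.bmdeg mu).
  by rewrite mpoly.mdegE (bigD1 i)//= leq_addr.
have code_inj (mu mu' : mpoly.bmultinom d K) : code mu = code mu' -> mu = mu'.
  move=> /digits_inj cmu; apply/val_inj/mpoly.mnmP; apply: cmu; exact: nuK.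
have P0 : \sum_(mu : mpoly.bmultinom d K) a mu *: 'X^(code mu) = 0 :> {poly R}.
  (* Evaluation at t is the hypothesis for the point with coordinates t ^ (K ^ i). *)
  apply: poly_eq_horner => t; rewrite horner0 -(a0 (\row_i t ^+ (K ^ i))) horner_sum.
  apply: eq_bigr => mu _; rewrite hornerZ hornerXn mulrC; congr (_ * _).
  rewrite /mi_pow /code expr_sum; apply: eq_bigr => i _.
  by rewrite mxE -exprM mulnC.
move/(congr1 (fun P : {poly R} => P`_(code nu))): P0.
rewrite coef0 coef_sum (bigD1 nu)//= coefZ coefXn eqxx mulr1 big1 ?addr0// => mu munu.
rewrite coefZ coefXn; case: eqP => [/code_inj e|_]; last by rewrite mulr0.
by rewrite e eqxx in munu.
Qed.

Definition mi_poly (K : nat) (g : 'rV[R]_d -> R) : Prop :=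
  exists c : mpoly.multinom d -> R,
    forall v, g v = \sum_(nu : mpoly.bmultinom d K) mi_pow v nu * c nu.

Lemma mi_poly_scale K (a : R) g : mi_poly K g -> mi_poly K (fun v => a * g v).
Proof.
move=> [c gc]; exists (fun nu => a * c nu) => v.
by rewrite gc mulr_sumr; apply: eq_bigr => nu _; rewrite mulrCA.
Qed.

Lemma mi_poly_sum K (J : Type) (r : seq J) (g : J -> 'rV[R]_d -> R) :
  (forall j, mi_poly K (g j)) -> mi_poly K (fun v => \sum_(j <- r) g j v).
Proof.
move=> /choice[c gc]; exists (fun nu => \sum_(j <- r) c j nu) => v.
under eq_bigr do rewrite gc.
by rewrite exchange_big; apply: eq_bigr => nu _; rewrite mulr_sumr.
Qed.

Lemma mi_poly_pow K nu : (mpoly.mdeg nu < K)%N -> mi_poly K (mi_pow ^~ nu).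
Proof.
move=> nuK; exists (fun mu => (mu == nu)%:R) => v.
rewrite (bigD1 (mpoly.BMultinom nuK))//= eqxx mulr1 big1 ?addr0// => mu.
by rewrite -val_eqE /= => /negbTE ->; rewrite mulr0.
Qed.

(** The accumulated monomial nu makes the induction on l go through: expanding
one argument v in the canonical basis multiplies the monomial by one more
coordinate and lowers the order of the form by one. *)
Lemma mi_poly_form K l (A : @mform R 'rV[R]_d l) nu : (mpoly.mdeg nu + l < K)%N ->
  mi_poly K (fun v => mi_pow v nu * mform_eval A (nseq l v)).
Proof.
elim: l A nu => [|l IH] A nu /= lK.
  under eq_fun do rewrite mulrC.
  by apply: mi_poly_scale; apply: mi_poly_pow; rewrite addn0 in lK.
have AE v : A v = \sum_i v ord0 i *: A (delta_mx 0 i).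
  have AD : {morph A : u w / u + w}.
    by move=> u w; rewrite -{1}[u]scale1r blin_linear scale1r.
  rewrite {1}[v]row_sum_delta (big_morph A AD (blin0 A)).
  by apply: eq_bigr => i _; rewrite blinZ.
have E v : mi_pow v nu * mform_eval (A v) (nseq l v) =
    \sum_i mi_pow v (mpoly.mnm_add nu (mpoly.mnm1 i)) *
      mform_eval (A (delta_mx 0 i)) (nseq l v).
  rewrite AE mform_eval_sum mulr_sumr; apply: eq_bigr => i _.
  by rewrite mform_evalZ mulrA mi_powD mi_pow1.
under eq_fun do rewrite E.
apply: mi_poly_sum => i; apply: IH.
by rewrite mpoly.mdegD mpoly.mdeg1 addn1 addSnnS.
Qed.

Lemma taylor_coefs_ex k (f : 'rV[R]_d -> R) x : exists c, taylor_coefs k f x c.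
Proof.
have [c fc] : mi_poly k.+1 (taylor k f x).
  apply: mi_poly_sum => l; apply: mi_poly_scale.
  have /= := @mi_poly_form k.+1 l (fderivn l f x) mpoly.mnm0.
  rewrite mpoly.mdeg0 add0n => /(_ (ltn_ord l))[c fc]; exists c => v.
  by rewrite -fc mi_pow0 mul1r D_nseq.
exists (fun nu => mi_fact nu * c nu) => v; rewrite fc; apply: eq_bigr => nu _.
by rewrite mulrA divfK// mi_fact_neq0.
Qed.

(** Multiplying v by a scales the monomial of index nu by a power of degree
|nu|, so sorting by powers of a recovers the homogeneous parts. *)
Lemma taylor_line_partial k (f : 'rV[R]_d -> R) x v :
  taylor_line k f x v =
  \sum_(nu : mpoly.bmultinom d k.+1)
    (mi_pow v nu * (partial k f x nu / mi_fact nu)) *: 'X^(mpoly.mdeg nu).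
Proof.
apply: poly_eq_horner => a; rewrite horner_taylor_line horner_sum.
rewrite (xgetPex 0 (taylor_coefs_ex k f x)); apply: eq_bigr => nu _.
by rewrite hornerZ hornerXn mi_powZ -/(partial k f x) [RHS]mulrC -!mulrA
  [(mi_fact nu)^-1 * _]mulrC.
Qed.

(** Both members are coefficients of v^nu in the part of degree k of the product
of the Taylor polynomials; on the right, families of multi-indices are grouped
according to their sum. *)
Lemma partial_prod (I : finType) (f : I -> 'rV[R]_d -> R) k x nu :
  (forall i, fdifferentiable k (f i) x) -> mpoly.mdeg nu = k ->
  partial k (fun y => \prod_i f i y) x nu / mi_fact nu =
  \sum_(mu : {ffun I -> mpoly.bmultinom d k.+1} |
        \big[@mpoly.mnm_add d/@mpoly.mnm0 d]_i (mu i : mpoly.multinom d) == nu)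
    \prod_i (partial k (f i) x (mu i) / mi_fact (mu i)).
Proof.
move=> fk nuk.
pose tot (mu : {ffun I -> mpoly.bmultinom d k.+1}) :=
  \big[@mpoly.mnm_add d/@mpoly.mnm0 d]_i (mu i : mpoly.multinom d).
pose b (mu : {ffun I -> mpoly.bmultinom d k.+1}) : R :=
  \prod_i (partial k (f i) x (mu i) / mi_fact (mu i)).
pose c (ka : mpoly.bmultinom d k.+1) : R :=
  partial k (fun y => \prod_i f i y) x ka / mi_fact ka.
have line_prod v : \prod_i taylor_line k (f i) x v =
    \sum_mu (mi_pow v (tot mu) * b mu) *: 'X^(mpoly.mdeg (tot mu)).
  under eq_bigr do rewrite taylor_line_partial.
  rewrite bigA_distr_bigA; apply: eq_bigr => mu _.
  rewrite scaler_prod big_split /=; congr (_ * _ *: _).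
    by rewrite (big_morph (mi_pow v) (mi_powD v) (mi_pow0 v)).
  by rewrite (big_morph (@mpoly.mdeg d) (@mpoly.mdegD d) (@mpoly.mdeg0 d)) expr_sum.
have coef_eq v :
    \sum_(ka : mpoly.bmultinom d k.+1) mi_pow v ka * (c ka * (k == mpoly.mdeg ka)%:R) =
    \sum_mu mi_pow v (tot mu) * (b mu * (k == mpoly.mdeg (tot mu))%:R).
  have := coef_prod_taylor_line v fk (leqnn k); rewrite line_prod => pk.
  transitivity ((taylor_line k (fun y => \prod_i f i y) x v)`_k).
    rewrite taylor_line_partial coef_sum; apply: eq_bigr => ka _.
    by rewrite coefZ coefXn mulrA.
  rewrite coef_poly ltnSn -pk coef_sum; apply: eq_bigr => mu _.
  by rewrite coefZ coefXn mulrA.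
have nuK : (mpoly.mdeg nu < k.+1)%N by rewrite nuk.
(* The difference of the two members at ka, restricted to the degree k. *)
pose a (ka : mpoly.bmultinom d k.+1) : R :=
  c ka * (k == mpoly.mdeg ka)%:R -
  \sum_(mu | tot mu == ka) b mu * (k == mpoly.mdeg ka)%:R.
have /(_ (mpoly.BMultinom nuK)) : forall ka, a ka = 0; last first.
  rewrite /a /= nuk eqxx mulr1 => /eqP; rewrite subr_eq0 => /eqP cE.
  rewrite -[LHS]/(c (mpoly.BMultinom nuK)) cE.
  by apply: eq_bigr => mu _; rewrite mulr1.
apply: mi_pow_free => v; rewrite /a.
under eq_bigr do rewrite mulrBr.
apply/eqP; rewrite sumrB subr_eq0 coef_eq; apply/eqP/esym.
under eq_bigr do rewrite mulr_sumr.
rewrite (exchange_big_dep xpredT)//=; apply: eq_bigr => mu _.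
have [muk|muk] := eqVneq k (mpoly.mdeg (tot mu)); last first.
  rewrite !mulr0 big1// => ka /eqP <-.
  by rewrite (negbTE muk) !mulr0.
have muK : (mpoly.mdeg (tot mu) < k.+1)%N by rewrite -muk.
rewrite (big_pred1 (mpoly.BMultinom muK)) => [|ka]; first by rewrite /= -muk eqxx.
by rewrite /= -val_eqE eq_sym.
Qed.

End MultiIndices.

(** * Ordered decompositions as words *)

Section OrderedDecompositions.
Context {n k : nat}.

Definition blocks (w : k.-tuple 'I_n) : {ffun 'I_n -> {set 'I_k}} :=
  [ffun i => [set a | tnth w a == i]%SET].

Lemma blocks_inj : injective blocks.
Proof.
move=> w w' ww'; apply: eq_from_tnth => a.
by have /ffunP/(_ (tnth w' a))/setP/(_ a) := ww'; rewrite !ffunE !inE eqxx => /eqP.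
Qed.

Lemma ordered_decompositionE (B : {ffun 'I_n -> {set 'I_k}}) :
  ordered_decomposition B = (B \in blocks @: [set: k.-tuple 'I_n])%SET.
Proof.
apply/idP/imsetP => [/andP[/forallP dB /eqP cB]|[w _ ->]].
  have /choice[h hB] : forall a, exists i, a \in B i.
    move=> a; have : a \in (\bigcup_i B i)%SET by rewrite cB inE.
    by case/bigcupP => i _ ai; exists i.
  exists [tuple h a | a < k] => //; apply/ffunP => i; apply/setP => a.
  rewrite ffunE inE tnth_mktuple; apply/idP/eqP => [ai|<-//].
  apply/eqP/negPn/negP => hai; have /forallP/(_ i)/implyP/(_ hai) := dB (h a).
  by move/disjointFr/(_ (hB a)); rewrite ai.
apply/andP; split.
  apply/forallP => i; apply/forallP => j; apply/implyP => ij.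
  rewrite -setI_eq0; apply/eqP/setP => a; rewrite !ffunE !inE.
  by apply/negbTE; apply: contra ij => /andP[/eqP <- /eqP <-].
apply/eqP/setP => a; rewrite inE; apply/bigcupP; exists (tnth w a) => //.
by rewrite ffunE inE.
Qed.

Lemma enum_blocks (T : Type) (u : 'I_k -> T) (w : k.-tuple 'I_n) i :
  [seq u b | b <- enum (blocks w i)] = subword w i [seq u a | a <- enum 'I_k].
Proof.
rewrite /subword -map_mask; congr map.
rewrite -[X in mask (map _ X)](map_tnth_enum w) -map_comp -filter_mask.
by rewrite enumT /enum_mem; apply: eq_filter => a; rewrite -[LHS]/(a \in _) ffunE inE.
Qed.

Lemma sum_ordered_decomposition (A : nmodType) (F : {ffun 'I_n -> {set 'I_k}} -> A) :
  \sum_(B | ordered_decomposition B) F B = \sum_(w : k.-tuple 'I_n) F (blocks w).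
Proof.
under eq_bigl do rewrite ordered_decompositionE.
rewrite big_imset /=; last by move=> w w' _ _; exact: blocks_inj.
by apply: eq_bigl => w; rewrite inE.
Qed.

End OrderedDecompositions.

Theorem proposition21 (R : realType) (k n : nat) (hn : (1 <= n)%N) :
  (forall (E : completeNormedModType R) (f : 'I_n -> E -> R) (x : E),
    (forall i, fdifferentiable k (f i) x) ->
    [/\ fdifferentiable k (fun y => \prod_i f i y) x,
        poly_map (fun v => \prod_i taylor k (f i) x v) /\
        (forall v : E,
          taylor k (fun y => \prod_i f i y) x v =
          poly_trunc k (fun w => \prod_i taylor k (f i) x w) v)
      & forall u : 'I_k -> E,
          D (fun y => \prod_i f i y) x [seq u a | a <- enum 'I_k] =
          \sum_(B : {ffun 'I_n -> {set 'I_k}} | ordered_decomposition B)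
            \prod_i D (f i) x [seq u b | b <- enum (B i)]]) /\
  (forall (d : nat) (f : 'I_n -> 'rV[R]_d -> R) (x : 'rV[R]_d),
    (forall i, fdifferentiable k (f i) x) ->
    forall nu : mpoly.multinom d, mpoly.mdeg nu = k ->
      partial k (fun y => \prod_i f i y) x nu / mi_fact nu =
      \sum_(mu : {ffun 'I_n -> mpoly.bmultinom d k.+1} |
            \big[@mpoly.mnm_add d/@mpoly.mnm0 d]_i (mu i : mpoly.multinom d)
              == nu)
        \prod_i (partial k (f i) x (mu i) / mi_fact (mu i))).
Proof.
split=> [E f x fk|d f x fk nu nuk]; last exact: partial_prod.
have pk := fdifferentiable_prod (index_enum 'I_n) fk.
split=> // [|u].
  split=> [|v]; last exact: taylor_prod.
  by eexists; exact: prod_taylor_components.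
rewrite (D_prod fk pk); last by rewrite size_map size_enum_ord.
rewrite (sum_ordered_decomposition
  (fun B => \prod_i D (f i) x [seq u b | b <- enum (B i)])).
by apply: eq_bigr => w _; apply: eq_bigr => i _; rewrite enum_blocks.
Qed.
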